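(* Let $f$ be an increasing $(h-s)_2$-convex function on $I=[0,\infty)$, and let $g:[0,\infty)\to[0,\infty)$. If $g$ is convex on $I$, then the composition $f\circ g$ is $(h-s)_2$-convex on $I$.
   Context: Let $J\subseteq\mathbb{R}$ with $[0,1]\subseteq J$, let $h:J\to\mathbb{R}$ be a nonnegative function with $h\not\equiv 0$, and let $s\in(0,1]$. Write $h^s(t)=(h(t))^s$, and let $I=[0,\infty)$. A function $f:[0,\infty)\to\mathbb{R}$ is $(h-s)_2$-convex on $I$ (in the second sense), written $f\in SX((h-s)_2,I)$, if $f$ is nonnegative and for all $u,v\in I$ and $t\in[0,1]$, $$f(tu+(1-t)v)\le h^s(t)f(u)+h^s(1-t)f(v).$$ *)

(* Defs.v *)
From HB Require Import structures.
From mathcomp Require Import all_boot all_order all_algebra.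
From mathcomp Require Import all_classical all_reals all_analysis.

Set Implicit Arguments.
Unset Strict Implicit.
Unset Printing Implicit Defensive.

Import Order.TTheory GRing.Theory Num.Theory.

Local Open Scope classical_set_scope.
Local Open Scope ring_scope.

(* Functions defined on a subset of R are total functions R -> R of which only
   the values on that subset are constrained: h is only used on [0, 1] here and
   f only on I, assumed to be an interval. The real power is [powR], for which
   0 `^ s = 0 when s != 0. *)
Definition hs2_convex (R : realType) (h : R -> R) (s : R) (I : set R)
    (f : R -> R) : Prop :=
  (forall x : R, I x -> 0 <= f x) /\
  (forall u v t : R, I u -> I v -> 0 <= t <= 1 ->
     f (t * u + (1 - t) * v) <= h t `^ s * f u + h (1 - t) `^ s * f v).

(* Main.v *)
Require Import Defs.
From mathcomp Require Import all_boot all_order all_algebra.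
From mathcomp Require Import all_classical all_reals all_analysis.

Set Implicit Arguments.
Unset Strict Implicit.
Unset Printing Implicit Defensive.

Import Order.TTheory GRing.Theory Num.Theory.

Local Open Scope classical_set_scope.
Local Open Scope ring_scope.

(** Convexity of [g] bounds [g (t * u + (1 - t) * v)] by the combination
    [t * g u + (1 - t) * g v] of two points of [0, +oo[. Monotonicity of [f]
    carries this bound through [f], and the [hs2_convex] inequality of [f] at
    the points [g u] and [g v] finishes. *)

(** The convexity inequality of a real function with an ordinary real weight
    [t] in place of an element of the type of weights [{i01 R}]. *)
Lemma convex_function_le (R : realType) (D : set R) (g : R -> R) (u v t : R) :
  convex_function (D : set R^o) g -> D u -> D v -> 0 <= t <= 1 ->
  g (t * u + (1 - t) * v) <= t * g u + (1 - t) * g v.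
Proof.
move=> g_convex Du Dv /andP[t0 t1].
by have := g_convex (Itv01 t0 t1) u v (mem_set Du) (mem_set Dv); rewrite !convRE.
Qed.

Theorem theorem2p4 (R : realType) (J : set R) (h : R -> R) (s : R)
    (f g : R -> R)
    (J01 : `[0, 1] `<=` J)
    (h_ge0 : forall t : R, J t -> 0 <= h t)
    (h_neq0 : exists2 t : R, J t & h t != 0)
    (s01 : 0 < s <= 1)
    (f_incr : {in `[0, +oo[ &, nondecreasing_fun f})
    (f_hs : hs2_convex h s `[0, +oo[ f)
    (g_ge0 : forall x : R, 0 <= x -> 0 <= g x)
    (g_convex : convex_function (`[0, +oo[%classic : set R) g) :
  hs2_convex h s `[0, +oo[ (f \o g).
Proof.
have [f_ge0 f_le] := f_hs.
have I_ge0 (x : R) : `[0, +oo[%classic x = (0 <= x) :> Prop.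
  by rewrite /= in_itv /= andbT.
split=> [x|u v t]; rewrite !I_ge0.
  by move=> x0; apply: f_ge0; rewrite I_ge0; exact: g_ge0.
move=> u0 v0 t01; have [t0 t1] := andP t01.
have conv_ge0 (x y : R) : 0 <= x -> 0 <= y -> 0 <= t * x + (1 - t) * y.
  by move=> x0 y0; rewrite addr_ge0 ?mulr_ge0 ?subr_ge0.
apply: (@le_trans _ _ (f (t * g u + (1 - t) * g v))); last first.
  by apply: f_le; rewrite ?I_ge0 //; exact: g_ge0.
apply: f_incr; rewrite ?in_itv/= ?andbT.
- exact/g_ge0/conv_ge0.
- by apply: conv_ge0; exact: g_ge0.
- by apply: (convex_function_le g_convex); rewrite ?I_ge0.
Qed.
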